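(* If $G : [a,b] \to \mathbb{R}$ is differentiable on $[a,b]$ and its derivative $\frac{d}{dx}G(x)$ is continuous on $[a,b]$, then \[ \int_a^b \frac{d}{dt}G(t)\,dt = G(b) - G(a). \]
   Context: The integral is the Riemann integral. The derivative of $G$ at $x \in (a,b)$ is $\frac{d}{dx}G(x) := \lim_{h\to 0} \frac{G(x+h)-G(x)}{h}$ when the limit exists; at the endpoints $a$ and $b$ the corresponding one-sided limits are used. *)

(* Defs.v *)
From Stdlib Require Import Reals.
From Coquelicot Require Import Coquelicot.

Local Open Scope R_scope.

Definition diff_quot (G : R -> R) (x h : R) : R := (G (x + h) - G x) / h.

(* A function on [a,b] is represented by a total function [R -> R]; the limits
   below only involve its values on [a,b]. *)
Definition is_deriv_on (a b : R) (G : R -> R) (x l : R) : Prop :=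
     (a < x < b /\ filterlim (diff_quot G x) (locally' 0) (locally l))
  \/ (x = a /\ filterlim (diff_quot G x) (at_right 0) (locally l))
  \/ (x = b /\ filterlim (diff_quot G x) (at_left 0) (locally l)).

Definition differentiable_on (a b : R) (G : R -> R) : Prop :=
  forall x : R, a <= x <= b -> exists l : R, is_deriv_on a b G x l.

(* For a < b there is at most one such limit, so that [iota] returns it whenever
   it exists; elsewhere the value is a dummy, as for [Derive]. *)
Definition deriv_on (a b : R) (G : R -> R) (x : R) : R :=
  iota (is_deriv_on a b G x).

(* Main.v *)
Require Import Defs.
From Stdlib Require Import Reals Lra.
From Coquelicot Require Import Coquelicot.

Local Open Scope R_scope.

(** Extend [G] beyond [a] and [b] by its tangent lines at the endpoints, and its
    derivative by constants. The extension is differentiable in the two-sided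
    sense at every point of [[a, b]] with continuous derivative, so the
    fundamental theorem of calculus on the whole line applies to it. *)

Definition clamp (a b y : R) : R := Rmax a (Rmin b y).

(** One formula for all three pieces: on [[a, b]] the linear term vanishes, and outside it [clamp]
    is constantly the nearer endpoint. *)
Definition tangent_extension (a b : R) (G g : R -> R) (y : R) : R :=
  G (clamp a b y) + g (clamp a b y) * (y - clamp a b y).

Lemma clamp_id (a b y : R) : a <= y <= b -> clamp a b y = y.
Proof.
intros H; unfold clamp.
rewrite Rmin_right, Rmax_right; lra.
Qed.

Lemma clamp_left (a b y : R) : a < b -> y <= a -> clamp a b y = a.
Proof.
intros Hab H; unfold clamp.
rewrite Rmin_right, Rmax_left; lra.
Qed.

Lemma clamp_right (a b y : R) : a < b -> b <= y -> clamp a b y = b.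
Proof.
intros Hab H; unfold clamp.
rewrite Rmin_left, Rmax_right; lra.
Qed.

Lemma clamp_bounds (a b y : R) : a < b -> a <= clamp a b y <= b.
Proof.
intros Hab; unfold clamp, Rmax, Rmin.
repeat destruct Rle_dec; lra.
Qed.

(** Projection onto an interval is 1-Lipschitz and fixes [x]. Hence a radius that works for [g] at
    [x] also works for [g] composed with [clamp]. *)
Lemma clamp_contracts (a b x y : R) :
  a < b -> a <= x <= b -> Rabs (clamp a b y - x) <= Rabs (y - x).
Proof.
intros Hab Hx; unfold clamp, Rmax, Rmin.
repeat destruct Rle_dec; unfold Rabs; repeat destruct Rcase_abs; lra.
Qed.

(** Since [a < b], the three clauses are mutually exclusive, so both limits are taken along the same
    proper filter. *)
Lemma is_deriv_on_unique (a b : R) (G : R -> R) (x l1 l2 : R) :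
  a < b -> is_deriv_on a b G x l1 -> is_deriv_on a b G x l2 -> l1 = l2.
Proof.
intros Hab [[Hx H1]|[[Hx H1]|[Hx H1]]] [[Hy H2]|[[Hy H2]|[Hy H2]]];
  try (exfalso; lra).
- exact (filterlim_locally_unique (FF := Proper_StrongProper _ (Rbar_locally'_filter 0)) _ _ _ H1 H2).
- exact (filterlim_locally_unique _ _ _ H1 H2).
- exact (filterlim_locally_unique _ _ _ H1 H2).
Qed.

Lemma deriv_on_correct (a b : R) (G : R -> R) (x : R) :
  a < b -> (exists l, is_deriv_on a b G x l) ->
  is_deriv_on a b G x (deriv_on a b G x).
Proof.
intros Hab [l Hl]; unfold deriv_on.
apply (iota_correct (V := R_CompleteNormedModule)); exists l; split; [exact Hl|].
intros l' Hl'; exact (is_deriv_on_unique _ _ _ _ _ _ Hab Hl Hl').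
Qed.

(** Merges the three clauses: at an endpoint, keeping [x + h] in [[a, b]] forces [h] to have the
    sign that the one-sided filter requires. *)
Lemma is_deriv_on_eps (a b : R) (G : R -> R) (x l : R) :
  is_deriv_on a b G x l ->
  forall eps : posreal, exists delta : posreal, forall h : R,
    h <> 0 -> Rabs h < delta -> a <= x + h <= b ->
    Rabs (diff_quot G x h - l) < eps.
Proof.
intros H eps.
assert (Hball : forall h : R, forall d : posreal, Rabs h < d -> ball 0 d h).
{ intros h d Hh; change (Rabs (h - 0) < d); now rewrite Rminus_0_r. }
destruct H as [[Hx H]|[[Hx H]|[Hx H]]];
  destruct (proj1 (filterlim_locally _ _) H eps) as [d Hd];
  exists d; intros h h0 Hh Hxh; apply Hd; try (now apply Hball); lra.
Qed.

(** For small [h], either [x + h] stays in [[a, b]] and the quotient is that of [G], or [x] is an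
    endpoint and [x + h] lies on its tangent line, where the quotient is exactly [g x]. *)
Lemma is_derive_tangent_extension (a b : R) (G g : R -> R) (x : R) :
  a < b -> a <= x <= b -> is_deriv_on a b G x (g x) ->
  is_derive (tangent_extension a b G g) x (g x).
Proof.
intros Hab Hx H.
apply is_derive_Reals; intros eps Heps.
destruct (is_deriv_on_eps _ _ _ _ _ H (mkposreal eps Heps)) as [d Hd].
(* A step shorter than [x - a] cannot cross [a]; if [x = a] there is nothing to exclude and the
   radius 1 is arbitrary. *)
assert (Hda : exists da : posreal, forall h, Rabs h < da -> x + h < a -> x = a).
{ destruct (Rle_lt_or_eq_dec a x (proj1 Hx)) as [Hax|Hax].
  - exists (mkposreal (x - a) (proj2 (Rlt_0_minus _ _) Hax)); simpl; intros h Hh.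
    apply Rabs_def2 in Hh; lra.
  - exists (mkposreal 1 Rlt_0_1); intros; lra. }
assert (Hdb : exists db : posreal, forall h, Rabs h < db -> b < x + h -> x = b).
{ destruct (Rle_lt_or_eq_dec x b (proj2 Hx)) as [Hxb|Hxb].
  - exists (mkposreal (b - x) (proj2 (Rlt_0_minus _ _) Hxb)); simpl; intros h Hh.
    apply Rabs_def2 in Hh; lra.
  - exists (mkposreal 1 Rlt_0_1); intros; lra. }
destruct Hda as [da Hda]; destruct Hdb as [db Hdb].
assert (Hmin : 0 < Rmin d (Rmin da db)).
{ repeat apply Rmin_pos; apply cond_pos. }
exists (mkposreal _ Hmin); simpl; intros h h0 Hh.
assert (Hh1 : Rabs h < d) by (eapply Rlt_le_trans; [exact Hh|apply Rmin_l]).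
assert (Hh2 : Rabs h < Rmin da db)
  by (eapply Rlt_le_trans; [exact Hh|apply Rmin_r]).
assert (Hh3 : Rabs h < da) by (eapply Rlt_le_trans; [exact Hh2|apply Rmin_l]).
assert (Hh4 : Rabs h < db) by (eapply Rlt_le_trans; [exact Hh2|apply Rmin_r]).
unfold tangent_extension; rewrite (clamp_id a b x Hx).
destruct (Rlt_le_dec (x + h) a) as [Hl|Hl].
{ assert (Hxa := Hda h Hh3 Hl); subst a.
  rewrite clamp_left by lra.
  replace (_ - g x) with 0 by (field; exact h0).
  now rewrite Rabs_R0. }
destruct (Rlt_le_dec b (x + h)) as [Hr|Hr].
{ assert (Hxb := Hdb h Hh4 Hr); subst b.
  rewrite clamp_right by lra.
  replace (_ - g x) with 0 by (field; exact h0).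
  now rewrite Rabs_R0. }
rewrite clamp_id by lra.
replace (_ - g x) with (diff_quot G x h - g x)
  by (unfold diff_quot; field; exact h0).
apply Hd; auto with real.
Qed.

Lemma continuous_clamp (a b : R) (g : R -> R) (x : R) :
  a < b -> continuous_on (fun y => a <= y <= b) g -> a <= x <= b ->
  continuous (fun y => g (clamp a b y)) x.
Proof.
intros Hab Hg Hx; unfold continuous.
rewrite (clamp_id a b x Hx).
apply filterlim_locally; intros eps.
destruct (proj1 (filterlim_locally _ _) (Hg x Hx) eps) as [d Hd].
exists d; intros y Hy; apply Hd.
- exact (Rle_lt_trans _ _ _ (clamp_contracts a b x y Hab Hx) Hy).
- exact (clamp_bounds a b y Hab).
Qed.

Theorem corollary6p4 (a b : R) (G : R -> R)
  (hab : a < b)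
  (hdiff : differentiable_on a b G)
  (hcont : continuous_on (fun x : R => a <= x <= b) (deriv_on a b G)) :
  ex_RInt (deriv_on a b G) a b /\
  RInt (deriv_on a b G) a b = G b - G a.
Proof.
set (g := deriv_on a b G) in *.
set (E := tangent_extension a b G g).
assert (HI : is_RInt g a b (G b - G a)).
(* Outside [[a, b]], [g] takes dummy values, so it may fail to be two-sidedly continuous at the
   endpoints. Composing with [clamp] repairs this without changing the integrand on [[a, b]]. *)
{ apply is_RInt_ext with (fun y => g (clamp a b y)).
  { rewrite Rmin_left, Rmax_right by lra; intros x Hx.
    now rewrite clamp_id by lra. }
  (* [E] agrees with [G] at both endpoints, its linear term being zero there. *)
  replace (G b - G a) with (minus (E b) (E a)).
  - apply (is_RInt_derive (V := R_CompleteNormedModule)); rewrite Rmin_left, Rmax_right by lra; intros x Hx.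
    + rewrite (clamp_id a b x Hx).
      apply is_derive_tangent_extension; [exact hab|exact Hx|].
      apply deriv_on_correct; [exact hab|exact (hdiff x Hx)].
    + now apply continuous_clamp.
  - unfold E, tangent_extension; rewrite !clamp_id by lra.
    unfold minus, plus, opp; simpl; ring. }
split.
- now exists (G b - G a).
- exact (is_RInt_unique _ _ _ _ HI).
Qed.
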